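(* Let $\sigma(x)=\max(0,x)$ be the ReLU activation. Then for all $\mu_1\in\mathbb R$ and all positive semidefinite $\begin{pmatrix}\nu_{11}&\nu_{12}\\ \nu_{12}&\nu_{22}\end{pmatrix}$ with $\nu_{11}>0$, $$L_\sigma(\mu_1;\nu_{11},\nu_{22},\nu_{12})=\nu_{12}\,\Phi\!\left(\frac{\mu_1}{\sqrt{\nu_{11}}}\right).$$
   Context: $\Phi$ is the standard normal CDF. $L_\sigma(\mu_1;\nu_{11},\nu_{22},\nu_{12}):=\operatorname{Cov}(\sigma(X_1),X_2)$ where $(X_1,X_2)$ is jointly normal with covariance matrix $\begin{pmatrix}\nu_{11}&\nu_{12}\\ \nu_{12}&\nu_{22}\end{pmatrix}$, $\mathbb E X_1=\mu_1$, and $\mathbb E X_2$ arbitrary (the value does not depend on it). *)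

(* Defs.v *)
From HB Require Import structures.
From mathcomp Require Import all_boot all_order all_algebra.
From mathcomp Require Import all_classical all_reals all_analysis.

Set Implicit Arguments.
Unset Strict Implicit.
Unset Printing Implicit Defensive.

Import Order.TTheory GRing.Theory Num.Theory.
Import numFieldNormedType.Exports.

Local Open Scope classical_set_scope.
Local Open Scope ring_scope.

Definition relu (R : realType) (x : R) : R := Num.max 0 x.

Definition Phi (R : realType) (x : R) : R :=
  fine (normal_prob (0 : R) 1 `]-oo, x]).

Definition psdmx (R : realType) (n : nat) (M : 'M[R]_n) : Prop :=
  M^T = M /\ forall u : 'cV[R]_n, 0 <= (u^T *m M *m u) 0 0.

Definition mx22 (R : realType) (a b c d : R) : 'M[R]_(1 + 1) :=
  block_mx a%:M b%:M c%:M d%:M.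

(* The law N(m, v) with variance v, including the degenerate case v = 0 (point
   mass at m); normal_prob m 0 is the uniform law on [0, 1], and its second
   parameter is a standard deviation. *)
Definition normal_law (R : realType) (m v : R) (A : set R) : \bar R :=
  if v == 0 then dirac m A else normal_prob m (Num.sqrt v) A.

(* Joint normality, covariance matrix possibly singular: every linear
   combination of the two variables has a (possibly degenerate) normal law. *)
Definition jointly_normal (d : measure_display) (T : measurableType d)
    (R : realType) (P : probability T R) (X1 X2 : {RV P >-> R}) : Prop :=
  forall a b : R, exists m v : R, 0 <= v /\
    forall A : set R, measurable A ->
      P ((fun w => a * X1 w + b * X2 w) @^-1` A) = normal_law m v A.

(* Main.v *)
Require Import Defs.
From HB Require Import structures.
From mathcomp Require Import all_boot all_order all_algebra.
From mathcomp Require Import all_classical all_reals all_analysis.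
From mathcomp Require Import measurable_realfun ring lra.

Set Implicit Arguments.
Unset Strict Implicit.
Unset Printing Implicit Defensive.

Import Order.TTheory GRing.Theory Num.Theory.
Import numFieldNormedType.Exports.

Local Open Scope classical_set_scope.
Local Open Scope ring_scope.

(* The only joint information available is the law of each combination
   a X1 + b X2. Split X2 - E X2 = k (X1 - mu1) + V with k = nu12 / nu11, so that
   V is uncorrelated with X1. Then X1 + t V and X1 - t V are normal with the
   same mean and variance, hence relu(X1 + t V)^2 and relu(X1 - t V)^2 have
   the same expectation. As the derivative of relu^2 is 2 relu, which is
   2-Lipschitz, these expectations differ by 4 t E[relu(X1) V] up to
   t^2 E[V^2]; letting t tend to 0, E[relu(X1) V] = 0. There remains
   k E[relu(X1) (X1 - mu1)], which Stein's integration by parts for the Gaussian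
   density evaluates to k nu11 Phi(mu1 / sqrt nu11). *)

(** * Integrals against normal laws, reduced to the standard one *)

Lemma ge0_integral_normal_prob (R : realType) (m s : R) (f : R -> \bar R) :
  measurable_fun [set: R] f -> (forall x, (0 <= f x)%E) ->
  (\int[normal_prob m s]_x f x =
   \int[lebesgue_measure]_x (f x * (normal_pdf m s x)%:E))%E.
Proof.
move=> mf f0; have dom := normal_prob_dominates m s.
rewrite -(Radon_Nikodym_SigmaFinite.change_of_variables dom)//.
set h := Radon_Nikodym_SigmaFinite.f _ _.
have ih : lebesgue_measure.-integrable [set: R] h.
  exact: Radon_Nikodym_SigmaFinite.f_integrable.
apply: ae_eq_integral => //.
- by apply: emeasurable_funM => //; exact: measurable_int ih.
- apply: emeasurable_funM => //; apply/measurable_EFinP.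
  exact: measurable_normal_pdf.
(* The Radon-Nikodym derivative [h] and [normal_pdf m s] have the same integral over every
   measurable set, so they agree almost everywhere. *)
- apply: ae_eqe_mul2l; apply: integral_ae_eq => //.
    by apply/measurable_EFinP; exact: measurable_normal_pdf.
  by move=> E _ mE; rewrite -Radon_Nikodym_SigmaFinite.f_integral.
Qed.

(** The Jacobian identity behind the substitution [x = m + s * z]. *)
Lemma normal_pdf_scale (R : realType) (m s z : R) : 0 < s ->
  normal_pdf m s (m + s * z) * s = normal_pdf 0 1 z.
Proof.
move=> s0; rewrite !normal_pdfE ?oner_neq0 ?gt_eqF//.
have -> : normal_fun m s (m + s * z) = normal_fun 0 1 z.
  rewrite /normal_fun expr1n subr0 addrAC subrr add0r exprMn.
  rewrite -[s ^+ 2 *+ 2]mulr_natr.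
  by rewrite -mulrN -mulf_div divff ?mul1r// sqrf_eq0 gt_eqF.
suff -> : @normal_peak R 1 = normal_peak s * s by ring.
rewrite /normal_peak expr1n mul1r -mulrnAr sqrtrM ?sqr_ge0// sqrtr_sqr.
by rewrite gtr0_norm// invfM mulrAC mulVf ?mul1r// gt_eqF.
Qed.

Lemma ge0_integral_normal_prob_scale (R : realType) (m s : R) (f : R -> R) :
  0 < s -> continuous f -> (forall x, 0 <= f x) ->
  (\int[normal_prob m s]_x (f x)%:E =
   \int[normal_prob 0 1]_z (f (m + s * z))%:E)%E.
Proof.
move=> s0 cf f0; have cF : continuous (fun z : R => m + s * z).
  by move=> z; apply: cvgD; [exact: cvg_cst|apply: cvgMr; exact: cvg_id].
rewrite ge0_integral_normal_prob; last first.
- by move=> z; rewrite lee_fin.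
- by apply/measurable_EFinP; exact: continuous_measurable_fun.
rewrite ge0_integral_normal_prob; last first.
- by move=> z; rewrite lee_fin.
- apply/measurable_EFinP; apply: continuous_measurable_fun => z.
  by apply: continuous_comp; [exact: cF|exact: cf].
have dF (z : R) : is_derive z 1 (fun z => m + s * z) s.
  apply: is_derive_eq; rewrite add0r mul1r; exact: mulr1.
have F'E : (fun z : R => m + s * z)^`()%classic = cst s.
  by apply/funext => z; rewrite derive1E derive_val.
under eq_integral do rewrite -EFinM.
rewrite (@increasing_ge0_integration_by_substitutionT _
    (fun z : R => m + s * z) (fun x => f x * normal_pdf m s x)).
- apply: eq_integral => z _.
  by rewrite F'E -EFinM -(normal_pdf_scale m z s0) mulrA.
- by move=> x y xy; rewrite ltrD2l ltr_pM2l.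
- by rewrite F'E => ?; exact: cvg_cst.
- by rewrite F'E; exact: is_cvg_cst.
- by rewrite F'E; exact: is_cvg_cst.
- by move=> z; case: (dF z).
- by apply: cvg_comp (cvg_addrl_Ny m); apply: gt0_cvgMrNy => //; exact: cvg_id.
- by apply: cvg_comp (cvg_addrl m); apply: gt0_cvgMry => //; exact: cvg_id.
- move=> x; apply: cvgM; first exact: cf.
  by apply: continuous_normal_pdf; rewrite gt_eqF.
- by move=> x; rewrite mulr_ge0// normal_pdf_ge0.
Qed.
(** Pushing [P] forward along [Y] leaves an integral over the normal law, which is then
    standardised. One formula also covers [v = 0]: as [Num.sqrt 0 = 0], the right integrand is
    constantly [f m], the value under the point mass. *)
Lemma ge0_integral_normal_law d (T : measurableType d) (R : realType)
    (P : probability T R) (Y : T -> R) (m v : R) (f : R -> R) :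
  measurable_fun setT Y -> 0 <= v ->
  (forall A, measurable A -> P (Y @^-1` A) = normal_law m v A) ->
  continuous f -> (forall x, 0 <= f x) ->
  (\int[P]_w (f (Y w))%:E =
   \int[normal_prob 0 1]_z (f (m + Num.sqrt v * z))%:E)%E.
Proof.
move=> mY v0 hY cf f0.
have mY' : @measurable_fun _ _ T (measurableTypeR R) setT Y by exact: mY.
pose Y' : {mfun T >-> measurableTypeR R} :=
  HB.pack Y (@isMeasurableFun.Build _ _ T (measurableTypeR R) Y mY').
have mf : @measurable_fun _ _ (measurableTypeR R) (\bar R) setT (EFin \o f).
  by apply/measurable_EFinP; exact: continuous_measurable_fun.
have -> : (\int[P]_w (f (Y w))%:E = \int[distribution P Y']_x (f x)%:E)%E.
  apply/esym; apply: (@ge0_integral_distribution _ _ _ _ _ P Y' _ mf) => x.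
  by rewrite lee_fin; exact: f0.
have [v0'|vn0] := eqVneq v 0.
  transitivity (\int[@dirac _ (measurableTypeR R) m R]_x (f x)%:E)%E.
    apply: eq_measure_integral => A mA _.
    by rewrite [LHS]hY// /normal_law v0' eqxx.
  rewrite integral_dirac// diracT mul1e v0' sqrtr0.
  under eq_integral do rewrite mul0r addr0.
  rewrite integral_cst// -[LHS]mule1; congr *%E.
  exact/esym/(probability_setT (normal_prob 0 1)).
rewrite -ge0_integral_normal_prob_scale// ?sqrtr_gt0 ?lt_neqAle 1?eq_sym ?vn0//.
apply: eq_measure_integral => A mA _.
by rewrite [LHS]hY// /normal_law (negbTE vn0).
Qed.

(** The positive and negative parts of [f] are continuous and nonnegative, so the nonnegative case
    applies to each. *)
Lemma integral_normal_law d (T : measurableType d) (R : realType)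
    (P : probability T R) (Y : T -> R) (m v : R) (f : R -> R) :
  measurable_fun setT Y -> 0 <= v ->
  (forall A, measurable A -> P (Y @^-1` A) = normal_law m v A) ->
  continuous f ->
  (\int[P]_w (f (Y w))%:E =
   \int[normal_prob 0 1]_z (f (m + Num.sqrt v * z))%:E)%E.
Proof.
move=> mY v0 hY cf; rewrite integralE [RHS]integralE; congr (_ - _)%E.
- under eq_integral do rewrite funeposE -EFin_max.
  under [RHS]eq_integral do rewrite funeposE -EFin_max.
  apply: (@ge0_integral_normal_law _ _ _ _ _ _ _
    (fun x => Num.max (f x) 0)) => //.
    move=> x; apply: (@continuous_max _ _ f (cst 0)); first exact: cf.
    exact: cvg_cst.
  by move=> x; rewrite le_max lexx orbT.
- under eq_integral do rewrite funenegE -EFinN -EFin_max.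
  under [RHS]eq_integral do rewrite funenegE -EFinN -EFin_max.
  apply: (@ge0_integral_normal_law _ _ _ _ _ _ _
    (fun x => Num.max (- f x) 0)) => //.
    move=> x; apply: (@continuous_max _ _ (fun x => - f x) (cst 0)).
      by apply: (@continuousN _ R^o); exact: cf.
    exact: cvg_cst.
  by move=> x; rewrite le_max lexx orbT.
Qed.

Lemma integrable_normal_law d (T : measurableType d) (R : realType)
    (P : probability T R) (Y : T -> R) (m v : R) (f : R -> R) :
  measurable_fun setT Y -> 0 <= v ->
  (forall A, measurable A -> P (Y @^-1` A) = normal_law m v A) ->
  continuous f ->
  (normal_prob 0 1).-integrable setT (fun z => (f (m + Num.sqrt v * z))%:E) ->
  P.-integrable setT (fun w => (f (Y w))%:E).
Proof.
move=> mY v0 hY cf /integrableP[_ fN]; apply/integrableP; split.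
  apply/measurable_EFinP; apply: measurableT_comp => //.
  exact: continuous_measurable_fun.
have cnf : continuous (fun x => `|f x|) by move=> x; apply: cvg_norm; exact: cf.
by have /= -> := integral_normal_law mY v0 hY cnf.
Qed.

Lemma integral_normal_prob (R : realType) (m s : R) (f : R -> R) :
  measurable_fun setT f ->
  (\int[normal_prob m s]_x (f x)%:E =
   \int[lebesgue_measure]_x (f x * normal_pdf m s x)%:E)%E.
Proof.
move=> mf; rewrite integralE [RHS]integralE.
have mEf : measurable_fun [set: R] (EFin \o f) by exact/measurable_EFinP.
rewrite !ge0_integral_normal_prob//; last 2 first.
- exact: measurable_funeneg.
- exact: measurable_funepos.
congr (_ - _)%E; apply: eq_integral => x _.
- rewrite !funeposE -!EFin_max -EFinM.
  by rewrite maxr_pMl ?normal_pdf_ge0// mul0r.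
- rewrite !funenegE -!EFinN -!EFin_max -EFinM.
  by rewrite maxr_pMl ?normal_pdf_ge0// mul0r mulNr.
Qed.

Lemma integrable_normal_prob (R : realType) (m s : R) (f : R -> R) :
  measurable_fun setT f ->
  lebesgue_measure.-integrable setT (fun x => (f x * normal_pdf m s x)%:E) ->
  (normal_prob m s).-integrable setT (EFin \o f).
Proof.
move=> mf /integrableP[_ fi]; apply/integrableP; split.
  exact/measurable_EFinP.
rewrite (@integral_normal_prob _ _ _ (fun x => `|f x|)); last first.
  exact: measurableT_comp.
apply: le_lt_trans fi; rewrite le_eqVlt; apply/orP; left; apply/eqP.
apply: eq_integral => x _ /=.
by rewrite normrM (ger0_norm (normal_pdf_ge0 _ _ _)).
Qed.

(** * Gaussian integrability and improper integrals *)

(** Domination by the normal density of variance 2: half of the Gaussian exponent absorbs the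
    square, through [x ^+ 2 / 4 <= expR (x ^+ 2 / 4)]. *)
Lemma integrable_sqr_std_normal_pdf (R : realType) :
  lebesgue_measure.-integrable [set: R]
    (fun x : R => (x ^+ 2 * normal_pdf 0 1 x)%:E).
Proof.
have s20 : Num.sqrt 2 != 0 :> R by rewrite gt_eqF// sqrtr_gt0.
(* The 4 comes from the bound on [x ^+ 2 / 4]; the quotient of peaks exchanges the normalising
   constants. *)
pose c : R := normal_peak 1 * 4 / normal_peak (Num.sqrt 2).
have ic : lebesgue_measure.-integrable [set: R]
    (fun x : R => c%:E * (normal_pdf 0 (Num.sqrt 2) x)%:E)%E.
  by apply: integrableZl => //; exact: integrable_normal_pdf.
apply: le_integrable ic => //.
- apply/measurable_EFinP; apply: measurable_funM; last first.
    exact: measurable_normal_pdf.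
  exact: exprn_measurable.
- move=> x _; rewrite -EFinM !abse_EFin lee_fin.
  rewrite !ger0_norm; last 2 first.
    rewrite mulr_ge0 ?normal_pdf_ge0//.
    by rewrite !mulr_ge0 ?invr_ge0 ?normal_peak_ge0.
    by rewrite mulr_ge0 ?normal_pdf_ge0 ?sqr_ge0.
  rewrite !normal_pdfE// ?oner_neq0//.
  rewrite /c [leRHS]mulrA divfK; last by rewrite gt_eqF ?normal_peak_gt0.
  rewrite mulrCA -[leRHS]mulrA ler_wpM2l ?normal_peak_ge0//.
  rewrite /normal_fun !subr0 expr1n sqr_sqrtr//.
  have -> : - x ^+ 2 / (1 *+ 2) = - x ^+ 2 / (2 *+ 2) - x ^+ 2 / 4.
    by rewrite -[2 *+ 2]mulrnA -[(2 * 2)%N]/4%N; field.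
  rewrite expRD mulrCA [leRHS]mulrC ler_wpM2l ?expR_ge0//.
  rewrite expRN ler_pdivrMr ?expR_gt0//.
  rewrite -ler_pdivrMl// mulrC.
  by apply: le_trans (expR_ge1Dx _); rewrite lerDr.
Qed.
(** The fundamental theorem holds on bounded intervals; dominated convergence, with [h] itself in
    absolute value as the bound, passes to the half-line. *)
Lemma integrable_continuous_FTC2y (R : realType) (h F : R -> R) (a l : R) :
  lebesgue_measure.-integrable `[a, +oo[ (EFin \o h) ->
  continuous h -> (forall x : R, is_derive x 1 F (h x)) ->
  F x @[x --> +oo] --> l ->
  (\int[lebesgue_measure]_(x in `[a, +oo[) (h x)%:E = (l - F a)%:E)%E.
Proof.
move=> ih ch dF Fl.
have cF : continuous F.
  by move=> x; apply/differentiable_continuous/derivable1_diffP; case: (dF x).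
(* Taking [n.+1] keeps every interval nondegenerate, including the first. *)
pose A n : set R := `[a, a + n.+1%:R]%classic.
pose h_ n : R -> \bar R := (EFin \o h) \_ (A n).
have mh : measurable_fun [set: R] (EFin \o h).
  by apply/measurable_EFinP; exact: continuous_measurable_fun.
have AE n : (\int[lebesgue_measure]_(x in `[a, +oo[) h_ n x =
    (F (a + n.+1%:R) - F a)%:E)%E.
  rewrite -integral_mkcondr (_ : `[a, +oo[ `&` A n = A n); last first.
    apply/setIidPr => x; rewrite /A/= !in_itv/= andbT.
    by case/andP.
  rewrite (@continuous_FTC2 _ h F)//.
  - by rewrite ltrDl.
  - exact: continuous_subspaceT.
  - split=> [x _||].
    + by case: (dF x).
    + by apply: cvg_at_right_filter; exact: cF.
    + by apply: cvg_at_left_filter; exact: cF.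
  - by move=> x _; rewrite derive1E derive_val.
have [] := @dominated_convergence _ _ _ (@lebesgue_measure R)
  `[a, +oo[%classic _ h_ (EFin \o h) (fun x => `|(h x)%:E|%E) _ _ _ _ _ => //.
- move=> n; apply/measurable_funTS; apply/(measurable_restrictT _ _).1.
    exact: measurable_itv.
  exact: measurable_funTS.
- exact: measurable_funTS.
- apply: aeW => x/= Dx; apply: cvg_near_cst; near=> n.
  rewrite /h_ patchE mem_set//= /A/= in_itv/=.
  move: Dx; rewrite in_itv/= andbT => ->/=.
  rewrite -lerBlDl (@le_trans _ _ n%:R) ?ler_nat//; near: n.
  exact: nbhs_infty_ger.
- exact: integrable_abse.
- apply: aeW => x /= n _; rewrite /h_ patchE; case: ifPn => //.
  by rewrite abse0.
move=> _ _ cvh.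
have cvF : (F (a + n.+1%:R) - F a)%:E @[n --> \oo] --> (l - F a)%:E.
  apply: cvg_EFin; first by near=> n.
  apply: cvgB; last exact: cvg_cst.
  have : F (a + n%:R) @[n --> \oo] --> l.
    by apply: cvg_comp Fl; apply: cvg_comp (cvg_addrl a); exact: cvgr_idn.
  by rewrite -(cvg_shiftS (fun n => F (a + n%:R))).
apply: (cvg_unique _ _ cvF) => //.
by move: cvh; under eq_fun do rewrite AE.
Unshelve. all: by end_near. Qed.

(** The density has finite mass and finite second moment, so integrability under the standard normal
    law reduces to a pointwise quadratic bound. *)
Lemma integrable_quadratic_growth_pdf (R : realType) (f : R -> R) (A B : R) :
  measurable_fun setT f -> (forall x, `|f x| <= A + B * x ^+ 2) ->
  lebesgue_measure.-integrable setT (fun x => (f x * normal_pdf 0 1 x)%:E).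
Proof.
move=> mf fAB.
have ig : lebesgue_measure.-integrable [set: R]
    (fun x : R => A%:E * (normal_pdf 0 1 x)%:E +
                  B%:E * (x ^+ 2 * normal_pdf 0 1 x)%:E)%E.
  apply: integrableD => //.
    by apply: integrableZl => //; exact: integrable_normal_pdf.
  by apply: integrableZl => //; exact: integrable_sqr_std_normal_pdf.
apply: le_integrable ig => //.
  apply/measurable_EFinP; apply: measurable_funM => //.
  exact: measurable_normal_pdf.
move=> x _; rewrite -!EFinM -EFinD !abse_EFin lee_fin mulrA -mulrDl !normrM.
rewrite ler_wpM2r// (le_trans (fAB x))//; exact: ler_norm.
Qed.

Lemma integrable_quadratic_growth (R : realType) (f : R -> R) (A B : R) :
  measurable_fun setT f -> (forall x, `|f x| <= A + B * x ^+ 2) ->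
  (normal_prob 0 1).-integrable setT (EFin \o f).
Proof.
move=> mf fAB; apply: integrable_normal_prob => //.
exact: integrable_quadratic_growth_pdf fAB.
Qed.

(** * The standard normal density and Stein's identity on a half-line *)

Lemma std_normal_pdfE (R : realType) :
  normal_pdf 0 1 = (fun x : R => normal_peak 1 * expR (- (x ^+ 2 / 2))).
Proof.
rewrite normal_pdfE ?oner_neq0//; apply/funext => x; rewrite /normal_fun.
by rewrite subr0 expr1n mulNr.
Qed.

Lemma is_derive_std_normal_pdf (R : realType) (x : R) :
  is_derive x 1 (normal_pdf 0 1) (- x * normal_pdf 0 1 x).
Proof.
rewrite std_normal_pdfE.
have d1 : is_derive x 1 (fun x : R => - (x ^+ 2 / 2)) (- x).
  apply: is_derive_eq; rewrite /GRing.scale/=.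
  by field.
have d2 : is_derive x 1 (expR \o (fun x : R => - (x ^+ 2 / 2)))
    (expR (- (x ^+ 2 / 2)) * (- x)).
  exact: is_derive1_comp.
have -> : (fun x : R => normal_peak 1 * expR (- (x ^+ 2 / 2))) =
    normal_peak 1 \*: (expR \o (fun x : R => - (x ^+ 2 / 2))) by [].
apply: is_derive_eq; rewrite /GRing.scale/=.
by ring.
Qed.

Lemma std_normal_pdfN (R : realType) (x : R) :
  normal_pdf 0 1 (- x) = normal_pdf 0 1 x.
Proof. by rewrite std_normal_pdfE sqrrN. Qed.

(** For [0 < x], the inequality [x ^+ 2 / 2 <= expR (x ^+ 2 / 2)] bounds the function by a constant
    times [x^-1]. *)
Lemma cvgy_id_std_normal_pdf (R : realType) :
  x * normal_pdf 0 1 x @[x --> +oo%R] --> (0 : R).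
Proof.
apply: (@squeeze_cvgr _ _ _ _ (fun=> 0)
  (fun x : R => (normal_peak 1 * 2) * x^-1)).
- near=> x; have x0 : 0 < x by near: x; exact: nbhs_pinfty_gt.
  rewrite mulr_ge0 ?normal_pdf_ge0 ?(ltW x0)//= std_normal_pdfE.
  rewrite /= mulrCA -[leRHS]mulrA ler_wpM2l ?normal_peak_ge0//.
  rewrite expRN ler_pdivrMr ?expR_gt0//.
  have {1}-> : x = 2 / x * (x ^+ 2 / 2) by field; rewrite gt_eqF.
  rewrite ler_wpM2l ?divr_ge0 ?(ltW x0)//.
  by apply: le_trans (expR_ge1Dx _); rewrite lerDr.
- exact: cvg_cst.
- rewrite -[X in _ --> X](mulr0 (normal_peak 1 * 2)); apply: cvgMr.
  apply/gtr0_cvgV0; last exact: cvg_id.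
  exact: nbhs_pinfty_gt.
Unshelve. all: by end_near. Qed.

Lemma cvgy_std_normal_pdf (R : realType) :
  normal_pdf 0 1 x @[x --> +oo%R] --> (0 : R).
Proof.
apply: squeeze_cvgr (cvg_cst 0) (@cvgy_id_std_normal_pdf R).
(* Once [1 <= x], the density lies below [x] times itself. *)
near=> x; rewrite normal_pdf_ge0/= ler_peMl ?normal_pdf_ge0//.
Unshelve. all: by end_near. Qed.

Lemma continuous_std_normal_pdf (R : realType) :
  continuous (normal_pdf (0 : R) 1).
Proof. by apply: continuous_normal_pdf; exact: oner_neq0. Qed.

(* [(z - a) n(z)], with [n] the density, has derivative [n(z) - (z - a) z n(z)]
   and vanishes at both ends of the half-line. *)
Lemma integral_tail_std_normal (R : realType) (a : R) :
  (\int[lebesgue_measure]_(z in `[a, +oo[) ((z - a) * z * normal_pdf 0 1 z)%:E =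
   \int[lebesgue_measure]_(z in `[a, +oo[) (normal_pdf 0 1 z)%:E)%E.
Proof.
have mI : @measurable _ (measurableTypeR R) `[a, +oo[%classic.
  exact: measurable_itv.
have in1 : lebesgue_measure.-integrable `[a, +oo[
    (fun z : R => (normal_pdf 0 1 z)%:E).
  by apply: integrableS (integrable_normal_pdf 0 1).
have czz : continuous (fun z : R => (z - a) * z).
  by move=> z; apply: cvgM; [apply: cvgB; [|exact: cvg_cst]|]; exact: cvg_id.
have in2 : lebesgue_measure.-integrable `[a, +oo[
    (fun z : R => ((z - a) * z * normal_pdf 0 1 z)%:E).
  have H : forall z : R, `|(z - a) * z| <= a ^+ 2 + 2 * z ^+ 2.
    by move=> z; rewrite ler_norml; apply/andP; split; nra.
  have := integrable_quadratic_growth_pdf (continuous_measurable_fun czz) H.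
  by apply: integrableS => //; exact: measurable_itv.
pose h (z : R) := normal_pdf 0 1 z - (z - a) * z * normal_pdf 0 1 z.
pose F (z : R) := (z - a) * normal_pdf 0 1 z.
have ih : lebesgue_measure.-integrable `[a, +oo[ (EFin \o h).
  rewrite (_ : EFin \o h = (fun z => (normal_pdf 0 1 z)%:E) \-
      (fun z : R => ((z - a) * z * normal_pdf 0 1 z)%:E))%E; last first.
    by apply/funext => z; rewrite /= EFinB.
  by apply: integrableB => //; exact: measurable_itv.
have ch : continuous h.
  move=> z; apply: cvgB; first exact: continuous_std_normal_pdf.
  by apply: cvgM; [exact: czz|exact: continuous_std_normal_pdf].
have dF (z : R) : is_derive z 1 F (h z).
  have dn := is_derive_std_normal_pdf z.
  have d1 : is_derive z 1 (fun z : R => z - a) 1.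
    by apply: is_derive_eq; rewrite subr0.
  have -> : F = (fun z : R => z - a) * normal_pdf 0 1 by [].
  by apply: is_derive_eq; rewrite /h /GRing.scale/=; ring.
have Fy : F z @[z --> +oo%R] --> (0 : R).
  rewrite (_ : F = (fun z => z * normal_pdf 0 1 z - a * normal_pdf 0 1 z)).
    rewrite -[X in _ --> X](subr0 0) -[in X in _ --> (_ - X)](mulr0 a).
    apply: cvgB; first exact: cvgy_id_std_normal_pdf.
    by apply: cvgMr; exact: cvgy_std_normal_pdf.
  by apply/funext => z; rewrite /F mulrBl.
have := integrable_continuous_FTC2y ih ch dF Fy.
under eq_integral do rewrite EFinB.
rewrite (integralB mI in1 in2).
rewrite /F subrr mul0r subrr => /eqP; rewrite sube_eq ?add0e.
- by move/eqP.
- by apply: integrable_fin_num.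
- exact: fin_num_adde_defr.
Qed.

(** The reflection [z] to [- z] preserves the density and exchanges the upper tail from [a] with the
    lower tail up to [- a]. *)
Lemma integral_std_normal_pdf_itvcy (R : realType) (a : R) :
  (\int[lebesgue_measure]_(z in `[a, +oo[) (normal_pdf 0 1 z)%:E =
   (Phi (- a))%:E)%E.
Proof.
rewrite /Phi fineK; last exact: (fin_num_measure (normal_prob 0 1)).
rewrite /normal_prob ge0_integration_by_substitutionNy.
- by apply: eq_integral => z _; rewrite /= std_normal_pdfN.
- by apply: continuous_subspaceT; exact: continuous_std_normal_pdf.
- by move=> z _; exact: normal_pdf_ge0.
Qed.

(** * ReLU and moments under normal laws *)

Lemma continuous_relu (R : realType) : continuous (@relu R).
Proof.
move=> x; apply: (@continuous_max _ _ (cst 0) idfun); first exact: cvg_cst.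
exact: cvg_id.
Qed.

Lemma measurable_relu (R : realType) : measurable_fun setT (@relu R).
Proof. by apply: continuous_measurable_fun; exact: continuous_relu. Qed.

(** [relu (z - a)] vanishes below [a]. It is used with [g] the identity for Stein's identity and
    with [g] constantly 1 for the mean of [relu z]. *)
Lemma integral_relu_std_normal (R : realType) (g : R -> R) (a : R) :
  measurable_fun setT g ->
  (\int[normal_prob 0 1]_z (relu (z - a) * g z)%:E =
   \int[lebesgue_measure]_(z in `[a, +oo[)
     ((z - a) * g z * normal_pdf 0 1 z)%:E)%E.
Proof.
move=> mg; rewrite integral_normal_prob; last first.
  apply: measurable_funM => //.
  by apply: measurableT_comp; [exact: measurable_relu|exact: measurable_funB].
rewrite [RHS]integral_mkcond; apply: eq_integral => z _.
rewrite patchE /relu; have [az|za] := leP a z.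
  by rewrite mem_set/= ?in_itv/= ?az// max_r// subr_ge0.
by rewrite memNset/= ?in_itv/= ?leNgt ?za// max_l ?mul0r// subr_le0 ltW.
Qed.

Lemma integral_relu_mul_std_normal (R : realType) (a : R) :
  (\int[normal_prob 0 1]_z (relu (z - a) * z)%:E = (Phi (- a))%:E)%E.
Proof.
rewrite (@integral_relu_std_normal _ (fun z => z))//.
exact: etrans (integral_tail_std_normal a) (integral_std_normal_pdf_itvcy a).
Qed.

(** By evenness this is twice a half-line integral; the tail identity at [a = 0] replaces [z ^+ 2]
    by 1 there, and evenness again gives the total mass. *)
Lemma integral_sqr_std_normal (R : realType) :
  (\int[normal_prob (0 : R) 1]_z (z ^+ 2)%:E = 1)%E.
Proof.
rewrite (@integral_normal_prob _ _ _ (fun z => z ^+ 2)); last first.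
  exact: exprn_measurable.
have cn := @continuous_std_normal_pdf R.
rewrite ge0_symfun_integralT; first last.
- by move=> z /=; rewrite sqrrN std_normal_pdfN.
- by move=> z; apply: cvgM; [exact: sqr_continuous|exact: cn].
- by move=> z; rewrite mulr_ge0 ?sqr_ge0 ?normal_pdf_ge0.
rewrite -set_itvcy.
have := integral_tail_std_normal (0 : R).
under eq_integral do rewrite subr0 -expr2.
move=> ->; rewrite set_itvcy -ge0_symfun_integralT.
- exact: integral_normal_pdf.
- exact: normal_pdf_ge0.
- exact: cn.
- by move=> z /=; rewrite std_normal_pdfN.
Qed.

(** Symmetry enters through nonnegative functions: [z = 2 * relu z - |z|], and evenness shows that
    [|z|] and [2 * relu z] have the same integral. *)
Lemma integral_id_std_normal (R : realType) :
  (\int[normal_prob (0 : R) 1]_z z%:E = 0)%E.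
Proof.
have cn := @continuous_std_normal_pdf R.
have inorm : (normal_prob 0 1).-integrable [set: R] (fun z : R => `|z|%:E).
  apply: (@integrable_quadratic_growth _ (fun z : R => `|z|) 1 1) => // z.
  by rewrite normr_id ler_norml; apply/andP; split; nra.
have irelu : (normal_prob 0 1).-integrable [set: R] (fun z : R => (relu z)%:E).
  apply: le_integrable inorm => //.
    by apply/measurable_EFinP; exact: measurable_relu.
  move=> z _; rewrite !abse_EFin lee_fin normr_id /relu.
  rewrite ger0_norm ?le_max ?lexx//.
  by rewrite ge_max normr_ge0 ler_norm.
have normE : (\int[normal_prob (0 : R) 1]_z `|z|%:E =
    2%:E * \int[normal_prob (0 : R) 1]_z (relu z)%:E)%E.
  have := @integral_relu_std_normal R (cst 1) 0 (measurable_cst _).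
  under eq_integral do rewrite subr0 mulr1.
  under [in RHS]eq_integral do rewrite subr0 mulr1.
  move=> ->.
  rewrite (@integral_normal_prob _ _ _ (fun z => `|z|))//.
  rewrite ge0_symfun_integralT.
  - rewrite set_itvcy; congr (_ * _)%E; apply: eq_integral => z.
    by rewrite inE/= => z0; rewrite ger0_norm.
  - by move=> z; rewrite mulr_ge0 ?normal_pdf_ge0.
  - by move=> z; apply: cvgM; [exact: norm_continuous|exact: cn].
  - by move=> z /=; rewrite normrN std_normal_pdfN.
transitivity (\int[normal_prob (0 : R) 1]_z (2%:E * (relu z)%:E - `|z|%:E))%E.
  apply: eq_integral => z _; rewrite -EFinM -EFinB /relu; congr EFin.
  by have [z0|z0] := leP 0 z; rewrite ?(ger0_norm z0) ?(ltr0_norm z0); ring.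
rewrite integralB//; last exact: integrableZl.
rewrite integralZl// -normE subee//; exact: integrable_fin_num.
Qed.

(** Joint normality supplies parameters [m] and [v] only existentially; these identities let them be
    read off from expectations and covariances, also when [v = 0]. *)
Lemma normal_law_moments d (T : measurableType d) (R : realType)
    (P : probability T R) (Y : T -> R) (m v : R) :
  measurable_fun setT Y -> 0 <= v ->
  (forall A, measurable A -> P (Y @^-1` A) = normal_law m v A) ->
  [/\ P.-integrable setT (fun w => (Y w ^+ 2)%:E),
      (\int[P]_w (Y w)%:E = m%:E)%E &
      (\int[P]_w ((Y w - m) ^+ 2)%:E = v%:E)%E].
Proof.
move=> mY v0 hY; set s := Num.sqrt v.
have cX2 : continuous (fun x : R => x ^+ 2) by exact: sqr_continuous.
have s2 : s ^+ 2 = v by rewrite sqr_sqrtr.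
have iz2 : (normal_prob 0 1).-integrable [set: R] (fun z : R => (z ^+ 2)%:E).
  apply: (@integrable_quadratic_growth _ (fun z : R => z ^+ 2) 0 1) => [|z].
    exact: exprn_measurable.
  by rewrite mul1r add0r ger0_norm ?sqr_ge0.
have iz : (normal_prob 0 1).-integrable [set: R] (fun z : R => z%:E).
  apply: (@integrable_quadratic_growth _ (fun z : R => z) 1 1) => // z.
  by rewrite ler_norml; apply/andP; split; nra.
split.
- apply: (@integrable_normal_law _ _ _ _ _ m v (fun x => x ^+ 2)) => //.
  (* The squares of [m + s * z] and [m - s * z] add up to [2 * m ^+ 2 + 2 * v * z ^+ 2]. *)
  apply: (@integrable_quadratic_growth _ (fun z : R => (m + s * z) ^+ 2)
    (2 * m ^+ 2) (2 * v)) => [|z].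
    by apply: measurable_funX; apply: measurable_funD.
  by rewrite ger0_norm ?sqr_ge0// -s2; have := sqr_ge0 (m - s * z); nra.
- have cid : continuous (fun x : R => x) by move=> x; exact: cvg_id.
  transitivity (\int[normal_prob 0 1]_z (m + s * z)%:E)%E.
    exact: (integral_normal_law mY v0 hY cid).
  under eq_integral do rewrite EFinD EFinM.
  rewrite integralD//; last first.
  + exact: integrableZl.
  + by apply: (@integrable_quadratic_growth _ (cst m) `|m| 0) => // z;
      rewrite mul0r addr0.
  rewrite integralZl// integral_id_std_normal mule0 adde0.
  rewrite integral_cst// -[RHS]mule1; congr *%E.
  exact: (probability_setT (normal_prob 0 1)).
- pose f (x : R) : R := (x - m) ^+ 2.
  have cf : continuous f.
    have cB : continuous (fun x : R => x - m).
      by move=> x; apply: cvgB; [exact: cvg_id|exact: cvg_cst].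
    rewrite (_ : f = (fun x => (x - m) * (x - m))).
      by move=> x; apply: cvgM; exact: cB.
    by apply/funext => x; rewrite /f expr2.
  transitivity (\int[normal_prob 0 1]_z (f (m + s * z))%:E)%E.
    exact: (integral_normal_law mY v0 hY cf).
  rewrite /f.
  transitivity (\int[normal_prob 0 1]_z (v%:E * (z ^+ 2)%:E))%E.
    by apply: eq_integral => z _; rewrite -EFinM -s2; congr EFin; ring.
  by rewrite integralZl// integral_sqr_std_normal mule1.
Qed.

(** Stein's identity for relu. Standardising pulls one factor [s] out of the relu and one out of
    [Y - m], hence [v]; the tail identity at [a = - (m / s)] does the rest. *)
Lemma integral_relu_normal_law d (T : measurableType d) (R : realType)
    (P : probability T R) (Y : T -> R) (m v : R) :
  measurable_fun setT Y -> 0 < v ->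
  (forall A, measurable A -> P (Y @^-1` A) = normal_law m v A) ->
  (\int[P]_w (relu (Y w) * (Y w - m))%:E = (v * Phi (m / Num.sqrt v))%:E)%E.
Proof.
move=> mY v0 hY; set s := Num.sqrt v.
have s0 : 0 < s by rewrite sqrtr_gt0.
have s2 : s ^+ 2 = v by rewrite sqr_sqrtr ?ltW.
pose f (x : R) : R := relu x * (x - m).
have cf : continuous f.
  move=> x; apply: cvgM; first exact: continuous_relu.
  by apply: cvgB; [exact: cvg_id|exact: cvg_cst].
transitivity (\int[normal_prob 0 1]_z (f (m + s * z))%:E)%E.
  exact: (integral_normal_law mY (ltW v0) hY cf).
rewrite /f.
transitivity
  (\int[normal_prob 0 1]_z (v%:E * (relu (z - - (m / s)) * z)%:E))%E.
  apply: eq_integral => z _; rewrite -EFinM; congr EFin.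
  have -> : m + s * z = s * (z - - (m / s)) by field; rewrite gt_eqF.
  rewrite /relu -[X in Num.max X _](mulr0 s) -maxr_pMr ?ltW//.
  by rewrite -s2; set r := Num.max _ _; field; rewrite gt_eqF.
rewrite integralZl//.
  by rewrite integral_relu_mul_std_normal opprK.
set a := - (m / s).
apply: (@integrable_quadratic_growth _ (fun z : R => relu (z - a) * z)
  (a ^+ 2) 2) => [|z].
  apply: measurable_funM => //; apply: measurableT_comp.
    exact: measurable_relu.
  exact: measurable_funB.
have := sqr_ge0 (z + a); have := sqr_ge0 (z - a).
have := sqr_ge0 z; have := sqr_ge0 a; rewrite !expr2 => ? ? ? ?.
by rewrite /relu ler_norml; case: (leP 0 (z - a)) => h; apply/andP; split; nra.
Qed.

(** * Orthogonality to relu from a symmetry in [t] *)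

(** The derivative [2 * relu] is nondecreasing and 2-Lipschitz, so both Taylor remainders of the
    square lie between 0 and [h ^+ 2], and so does their difference in absolute value. The proof
    checks the sign patterns. *)
Lemma relu_sqr_central_difference (R : realType) (x h : R) :
  `|relu (x + h) ^+ 2 - relu (x - h) ^+ 2 - 4 * (relu x * h)| <= h ^+ 2.
Proof.
rewrite /relu ler_norml.
by case: (leP 0 (x + h)) => ?; case: (leP 0 (x - h)) => ?; case: (leP 0 x) => ?;
  apply/andP; split; nra.
Qed.

Lemma integrable_le_sqr d (T : measurableType d) (R : realType)
    (P : probability T R) (X Y f : T -> R) (A B C : R) :
  P.-integrable setT (fun w => (X w ^+ 2)%:E) ->
  P.-integrable setT (fun w => (Y w ^+ 2)%:E) ->
  measurable_fun setT f ->
  (forall w, `|f w| <= A + B * X w ^+ 2 + C * Y w ^+ 2) ->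
  P.-integrable setT (fun w => (f w)%:E).
Proof.
move=> iX iY mf fABC.
have ig : P.-integrable setT
    (fun w => A%:E + B%:E * (X w ^+ 2)%:E + C%:E * (Y w ^+ 2)%:E)%E.
  apply: integrableD => //; last exact: integrableZl.
  apply: integrableD => //; last exact: integrableZl.
  exact: finite_measure_integrable_cst.
apply: le_integrable ig => //; first exact/measurable_EFinP.
move=> w _; rewrite -!EFinM -!EFinD !abse_EFin lee_fin.
by rewrite (le_trans (fABC w))// ler_norm.
Qed.

Lemma integrable_mul_sqr d (T : measurableType d) (R : realType)
    (P : probability T R) (X Y : T -> R) :
  measurable_fun setT X -> measurable_fun setT Y ->
  P.-integrable setT (fun w => (X w ^+ 2)%:E) ->
  P.-integrable setT (fun w => (Y w ^+ 2)%:E) ->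
  P.-integrable setT (EFin \o (fun w => X w * Y w)).
Proof.
move=> mX mY iX iY; apply: (@integrable_le_sqr _ _ _ _ X Y _ 0 1 1) => // [|w].
  exact: measurable_funM.
have := sqr_ge0 (X w - Y w); have := sqr_ge0 (X w + Y w).
have := sqr_ge0 (X w); have := sqr_ge0 (Y w); rewrite !expr2 => ? ? ? ?.
by rewrite ler_norml; apply/andP; split; nra.
Qed.

Lemma integrable_relu_sqr d (T : measurableType d) (R : realType)
    (P : probability T R) (X : T -> R) :
  measurable_fun setT X ->
  P.-integrable setT (fun w => (X w ^+ 2)%:E) ->
  P.-integrable setT (fun w => (relu (X w) ^+ 2)%:E).
Proof.
move=> mX iX; apply: (@integrable_le_sqr _ _ _ _ X X _ 0 1 0) => // [|w].
  apply: measurable_funX.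
  by apply: measurableT_comp => //; exact: measurable_relu.
rewrite ger0_norm ?sqr_ge0// add0r mul1r mul0r addr0 /relu.
by case: (leP 0 (X w)) => // _; rewrite expr0n sqr_ge0.
Qed.

(** Integrating the central difference bound with [h = t * V] gives [4 * |t * c| <= t ^+ 2 * q],
    linear against quadratic in [t], which forces [c = 0]. *)
Lemma integral_relu_mul_eq0 d (T : measurableType d) (R : realType)
    (P : probability T R) (X V : T -> R) :
  measurable_fun setT X -> measurable_fun setT V ->
  P.-integrable setT (fun w => (X w ^+ 2)%:E) ->
  P.-integrable setT (fun w => (V w ^+ 2)%:E) ->
  (forall t : R, \int[P]_w (relu (X w + t * V w) ^+ 2) =
                 \int[P]_w (relu (X w - t * V w) ^+ 2)) ->
  \int[P]_w (relu (X w) * V w) = 0.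
Proof.
move=> mX mV iX iV sym.
have mrelu (f : T -> R) : measurable_fun setT f ->
    measurable_fun setT (fun w => relu (f w)).
  by move=> mf; apply: measurableT_comp mf; exact: measurable_relu.
have isq t : P.-integrable setT (EFin \o (fun w => relu (X w + t * V w) ^+ 2)).
  apply: integrable_relu_sqr.
    by apply: measurable_funD => //; exact: measurable_funM.
  apply: (@integrable_le_sqr _ _ _ _ X V _ 0 2 (2 * t ^+ 2)) => // [|w].
    apply: measurable_funX; apply: measurable_funD => //.
    exact: measurable_funM.
  rewrite ger0_norm ?sqr_ge0// add0r.
  by have := sqr_ge0 (X w - t * V w); rewrite !expr2 => ?; nra.
have irV : P.-integrable setT (EFin \o (fun w => relu (X w) * V w)).
  apply: integrable_mul_sqr => //; first exact: mrelu.
  exact: integrable_relu_sqr.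
set c := \int[P]_w (relu (X w) * V w).
set q := \int[P]_w (V w ^+ 2).
have q0 : 0 <= q by apply: Rintegral_ge0 => w _; exact: sqr_ge0.
have bound (t : R) : `|4 * (t * c)| <= t ^+ 2 * q.
  have isqN : P.-integrable setT (EFin \o (fun w => relu (X w - t * V w) ^+ 2)).
    have := isq (- t); apply: eq_integrable => // w _ /=.
    by rewrite mulNr.
  pose D w := relu (X w + t * V w) ^+ 2 - relu (X w - t * V w) ^+ 2
     - 4 * t * (relu (X w) * V w).
  have iD1 : P.-integrable setT (EFin \o (fun w =>
      relu (X w + t * V w) ^+ 2 - relu (X w - t * V w) ^+ 2)).
    have := integrableB measurableT (isq t) isqN.
    by apply: eq_integrable => // w _; rewrite /= EFinB.
  have iD2 : P.-integrable setT
      (EFin \o (fun w => 4 * t * (relu (X w) * V w))).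
    have := integrableZl measurableT (4 * t) irV.
    by apply: eq_integrable => // w _; rewrite /= EFinM.
  have iD : P.-integrable setT (EFin \o D).
    have := integrableB measurableT iD1 iD2.
    by apply: eq_integrable => // w _; rewrite /= EFinB.
  (* By [sym] the two squared terms of [D] cancel after integration. *)
  have -> : 4 * (t * c) = - \int[P]_w D w.
    by rewrite !RintegralB// RintegralZl// sym subrr sub0r opprK mulrA.
  rewrite normrN (le_trans (le_normr_Rintegral _ iD))// /q -RintegralZl//.
  apply: le_Rintegral => //.
  - exact: integrable_norm.
  - have := integrableZl measurableT (t ^+ 2) iV.
    by apply: eq_integrable => // w _; rewrite /= EFinM.
  - move=> w _; rewrite -exprMn /D -mulrA (mulrCA t).
    exact: relu_sqr_central_difference.
apply/eqP; apply: contraT => c0.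
have cp : 0 < `|c| by rewrite normr_gt0.
have q1 : 0 < q + 1 by rewrite ltr_wpDl.
(* A single small [t] replaces the limit: here [4 * t * |c| = 4 * t ^+ 2 * (q + 1)] exceeds
   [t ^+ 2 * q]. The added 1 keeps the denominator positive when [q = 0]. *)
pose t := `|c| / (q + 1).
have t0 : 0 < t by rewrite divr_gt0.
have ct : `|c| = t * (q + 1) by rewrite /t divfK// gt_eqF.
have := bound t.
rewrite normrM [X in _ * X]normrM (gtr0_norm t0) (@ger0_norm _ 4)// ct.
by rewrite leNgt => /negP; case; nra.
Qed.

(** * The covariance of the rectified variable with [X2] *)

Theorem lemmaE3 (R : realType) (mu1 nu11 nu22 nu12 : R)
  (hpsd : psdmx (mx22 nu11 nu12 nu12 nu22)) (h11 : 0 < nu11)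
  (d : measure_display) (T : measurableType d) (P : probability T R)
  (X1 X2 : {RV P >-> R})
  (hX : jointly_normal X1 X2)
  (hE1 : expectation P X1 = mu1%:E)
  (hC11 : covariance P X1 X1 = nu11%:E)
  (hC22 : covariance P X2 X2 = nu22%:E)
  (hC12 : covariance P X1 X2 = nu12%:E) :
  covariance P (@relu R \o X1) X2
    = (nu12 * Phi (mu1 / Num.sqrt nu11))%:E.
Proof.
have mX1 : measurable_fun setT X1 by exact: measurable_funPT.
have mX2 : measurable_fun setT X2 by exact: measurable_funPT.
have mrX1 : measurable_fun setT (fun w => relu (X1 w)).
  by apply: measurableT_comp => //; exact: measurable_relu.
have [m1 [v1 [v10 law1]]] : exists m v : R, 0 <= v /\
    forall A : set R, measurable A -> P (X1 @^-1` A) = normal_law m v A.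
  have [m [v [v0 law]]] := hX 1 0; exists m, v; split; [exact: v0|move=> A mA].
  rewrite -law//; have -> // : (fun w => 1 * X1 w + 0 * X2 w) = (X1 : T -> R).
  by apply/funext => w; rewrite mul1r mul0r addr0.
have [m2 [v2 [v20 law2]]] : exists m v : R, 0 <= v /\
    forall A : set R, measurable A -> P (X2 @^-1` A) = normal_law m v A.
  have [m [v [v0 law]]] := hX 0 1; exists m, v; split; [exact: v0|move=> A mA].
  rewrite -law//; have -> // : (fun w => 0 * X1 w + 1 * X2 w) = (X2 : T -> R).
  by apply/funext => w; rewrite mul1r mul0r add0r.
have [i1 E1 V1] := normal_law_moments mX1 v10 law1.
have [i2 E2 V2] := normal_law_moments mX2 v20 law2.
have m1E : m1 = mu1.
  by apply: EFin_inj; rewrite -E1 -hE1 unlock.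
subst m1.
have EX2 : expectation P X2 = m2%:E by rewrite unlock.
have v1E : v1 = nu11.
  by apply: EFin_inj; rewrite -V1 -hC11 unlock hE1 unlock.
subst v1.
have C12 : \int[P]_w ((X1 w - mu1) * (X2 w - m2)) = nu12.
  by have := hC12; rewrite unlock hE1 EX2 unlock => /(congr1 fine).
have iquad (f : T -> R) A B C : measurable_fun setT f ->
    (forall w, `|f w| <= A + B * X1 w ^+ 2 + C * X2 w ^+ 2) ->
    P.-integrable setT (fun w => (f w)%:E) by exact: integrable_le_sqr.
pose k := nu12 / nu11.
(* The constant term of [V] once it is expanded in [X1] and [X2]. *)
pose e := k * mu1 - m2.
pose U w := X1 w - mu1.
pose V w := (X2 w - m2) - k * U w.
have mU : measurable_fun setT U by exact: measurable_funB.
have mV : measurable_fun setT V.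
  by apply: measurable_funB; [exact: measurable_funB|exact: measurable_funM].
have VE w : V w = X2 w - k * X1 w + e by rewrite /V /U /e; ring.
have iX1 : P.-integrable setT (EFin \o X1).
  apply: (iquad _ 1 1 0) => // w.
  by rewrite mul0r addr0 mul1r ler_norml; apply/andP; split; nra.
have iX2 : P.-integrable setT (EFin \o X2).
  apply: (iquad _ 1 0 1) => // w.
  by rewrite mul0r addr0 mul1r ler_norml; apply/andP; split; nra.
have iU2 : P.-integrable setT (EFin \o (fun w => U w ^+ 2)).
  apply: (iquad _ (2 * mu1 ^+ 2) 2 0); first exact: measurable_funX.
  move=> w; rewrite mul0r addr0 ger0_norm ?sqr_ge0// /U.
  by have := sqr_ge0 (X1 w + mu1); rewrite !expr2 => ?; nra.
have iV2 : P.-integrable setT (EFin \o (fun w => V w ^+ 2)).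
  (* The square of a sum of three terms is at most three times the sum of their squares. *)
  apply: (iquad _ (3 * e ^+ 2) (3 * k ^+ 2) 3); first exact: measurable_funX.
  move=> w; rewrite ger0_norm ?sqr_ge0// VE.
  have := sqr_ge0 (X2 w + k * X1 w); have := sqr_ge0 (X2 w - e).
  by have := sqr_ge0 (k * X1 w + e); rewrite !expr2 => ? ? ?; nra.
have iUV : P.-integrable setT (EFin \o (fun w => U w * V w)).
  exact: integrable_mul_sqr.
have ir2 := integrable_relu_sqr mX1 i1.
have irU : P.-integrable setT (EFin \o (fun w => relu (X1 w) * U w)).
  exact: integrable_mul_sqr.
have irV : P.-integrable setT (EFin \o (fun w => relu (X1 w) * V w)).
  exact: integrable_mul_sqr.
have ir : P.-integrable setT (EFin \o (fun w => relu (X1 w))).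
  apply: (iquad _ 1 1 0) => // w; rewrite mul0r addr0 mul1r /relu ler_norml.
  by case: (leP 0 (X1 w)) => h; apply/andP; split; nra.
have irX2 : P.-integrable setT (EFin \o (fun w => relu (X1 w) * X2 w)).
  exact: integrable_mul_sqr.
have iZ (f : T -> R) (c : R) : P.-integrable setT (EFin \o f) ->
    P.-integrable setT (EFin \o (fun w => c * f w)).
  move=> /(integrableZl measurableT c).
  by apply: eq_integrable => // w _ /=; rewrite EFinM.
have iD (f g : T -> R) : P.-integrable setT (EFin \o f) ->
    P.-integrable setT (EFin \o g) ->
    P.-integrable setT (EFin \o (fun w => f w + g w)).
  by move=> f1 g1; apply: eq_integrable (integrableD measurableT f1 g1).
have RU2 : \int[P]_w (U w ^+ 2) = nu11 by rewrite /Rintegral V1.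
(* This is where [k] is chosen: [nu12 - k * nu11 = 0]. *)
have UV0 : \int[P]_w (U w * V w) = 0.
  have iUX : P.-integrable setT (EFin \o (fun w => U w * (X2 w - m2))).
    have := iD _ _ iUV (iZ _ k iU2); apply: eq_integrable => // w _ /=.
    by rewrite /V; congr EFin; ring.
  transitivity (\int[P]_w (U w * (X2 w - m2) + (- k) * U w ^+ 2)).
    by apply: eq_Rintegral => w _; rewrite /V; ring.
  rewrite RintegralD//; last exact: iZ.
  by rewrite RintegralZl// C12 RU2 /k; field; rewrite gt_eqF.
set q := \int[P]_w (V w ^+ 2).
have RE1 : \int[P]_w (X1 w) = mu1 by rewrite /Rintegral E1.
have RE2 : \int[P]_w (X2 w) = m2 by rewrite /Rintegral E2.
(* The right side depends on [t] only through [t ^+ 2]. The variable is [Y + t * e] with [Y] a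
   linear combination of [X1] and [X2]; its mean is [mu1], and by [UV0] its variance has no term
   linear in [t]. *)
have sqE t : \int[P]_w (relu (X1 w + t * V w) ^+ 2) =
    fine (\int[normal_prob 0 1]_z
      (relu (mu1 + Num.sqrt (nu11 + t ^+ 2 * q) * z) ^+ 2)%:E)%E.
  have [m [v [v0 law]]] := hX (1 - t * k) t.
  pose Y w := (1 - t * k) * X1 w + t * X2 w.
  have mY : measurable_fun setT Y.
    by apply: measurable_funD; exact: measurable_funM.
  have [_ EY VY] := normal_law_moments mY v0 law.
  have mE : m = mu1 - t * e.
    have <- : \int[P]_w (Y w) = m by rewrite /Rintegral EY.
    rewrite RintegralD//; [|exact: iZ|exact: iZ].
    by rewrite !RintegralZl// RE1 RE2 /e; ring.
  have vE : v = nu11 + t ^+ 2 * q.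
    have <- : \int[P]_w ((Y w - m) ^+ 2) = v by rewrite /Rintegral VY.
    transitivity (\int[P]_w
        (U w ^+ 2 + 2 * t * (U w * V w) + t ^+ 2 * V w ^+ 2)).
      by apply: eq_Rintegral => w _; rewrite VE mE /Y /U; ring.
    rewrite RintegralD//; [|exact: iD (iZ _ _ _)|exact: iZ].
    rewrite RintegralD//; last exact: iZ.
    by rewrite !RintegralZl// RU2 UV0 mulr0 addr0.
  (* Joint normality gives the law of the linear [Y], so the shift [t * e] is put into the test
     function. *)
  pose f (y : R) : R := relu (y + t * e) ^+ 2.
  have cf : continuous f.
    have cr : continuous (fun y : R => relu (y + t * e)).
      move=> y; apply: (@continuous_comp _ _ _ (fun y => y + t * e) (@relu R)).
        by apply: cvgD; [exact: cvg_id|exact: cvg_cst].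
      exact: continuous_relu.
    rewrite (_ : f = (fun y => relu (y + t * e) * relu (y + t * e))).
      by move=> y; apply: cvgM; exact: cr.
    by apply/funext => y; rewrite /f expr2.
  rewrite /Rintegral; congr fine; rewrite -vE.
  transitivity (\int[P]_w (f (Y w))%:E)%E.
    apply: eq_integral => w _; rewrite /f VE /Y; congr ((relu _ ^+ 2)%:E).
    by ring.
  rewrite (integral_normal_law mY v0 law cf).
  apply: eq_integral => z _; rewrite /f mE; congr ((relu _ ^+ 2)%:E).
  by ring.
have rV0 : \int[P]_w (relu (X1 w) * V w) = 0.
  (* Reading [t ^+ 2] as the square of [- t] and applying [sqE] backwards exchanges [t] and
     [- t]. *)
  apply: integral_relu_mul_eq0 => // t; rewrite sqE -[t ^+ 2]sqrrN -sqE.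
  by apply: eq_Rintegral => w _; rewrite mulNr.
have rU : \int[P]_w (relu (X1 w) * U w) = nu11 * Phi (mu1 / Num.sqrt nu11).
  by rewrite /Rintegral (integral_relu_normal_law mX1 h11 law1).
have rX2 : \int[P]_w (relu (X1 w) * X2 w) =
    nu12 * Phi (mu1 / Num.sqrt nu11) + m2 * \int[P]_w relu (X1 w).
  (* From [X2 = V + k * U + m2]; the [m2] term is later cancelled by the product of expectations in
     the covariance. *)
  transitivity (\int[P]_w (relu (X1 w) * V w + k * (relu (X1 w) * U w)
      + m2 * relu (X1 w))).
    by apply: eq_Rintegral => w _; rewrite /V; ring.
  rewrite RintegralD//; [|exact: iD (iZ _ _ _)|exact: iZ].
  rewrite RintegralD//; last exact: iZ.
  rewrite !RintegralZl// rV0 rU add0r /k mulrA divfK//.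
  by rewrite gt_eqF.
rewrite covarianceE ?inE; [|exact/Lfun1_integrable..].
rewrite EX2 unlock.
have -> : (\int[P]_w ((@relu R \o X1) w)%:E = (\int[P]_w relu (X1 w))%:E)%E.
  by rewrite /Rintegral fineK//; exact: (integrable_fin_num measurableT ir).
have -> : (\int[P]_w (((@relu R \o X1) * X2)%R w)%:E =
    (\int[P]_w (relu (X1 w) * X2 w))%:E)%E.
  by rewrite /Rintegral fineK//; exact: (integrable_fin_num measurableT irX2).
by rewrite rX2 -EFinM -EFinB; congr EFin; ring.
Qed.
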